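(* Let $r=3$, $q=e^{\pi i/3}$. The $3$-dimensional representation $\boldsymbol W_{4,2}/\boldsymbol S_{4,2}$ of the braid group $B_4$ is equivalent to the specialization at $x=q^5$, $y=z=1$ of the $3$-dimensional representation of the cubic Hecke algebra $H_4$ defined by $$\sigma_1,\sigma_3\mapsto\begin{pmatrix} z&0&0\\ xz+y^2&y&0\\ y&1&x\end{pmatrix},\qquad \sigma_2\mapsto\begin{pmatrix}x&-1&y\\0&y&-xz-y^2\\0&0&z\end{pmatrix}.$$
   Context: For $x,y,z\in\mathbb C$, the cubic Hecke algebra $H_n$ is the quotient of the group algebra $\mathbb C B_n$ of the braid group by the relation $(\sigma_1-x)(\sigma_1-y)(\sigma_1-z)=0$; the displayed matrices define a representation of $H_4$, hence of $B_4$. Let $r=3$, $q=e^{\pi i/3}$, $s=q^{2}$, $\{x\}=q^x-q^{-x}$, $[x]=\{x\}/\{1\}$, $[m]!=[m]\cdots[1]$, $\begin{bmatrix} a\\ b\end{bmatrix}=\frac{[a]!}{[a-b]![b]!}$. Let $V$ be the complex vector space with basis $u_0,u_1,u_2$ ($u_{-1}=u_3=0$) and operators $Eu_m=u_{m-1}$, $Fu_m=[m+1][2-m]u_{m+1}$, $Ku_m=sq^{-2m}u_m$. On $V^{\otimes4}$, $E$ acts as $\sum_{i=1}^4 1^{\otimes(i-1)}\otimes E\otimes K^{\otimes(4-i)}$ and $F$ as $\sum_{i=1}^4 (K^{-1})^{\otimes(i-1)}\otimes F\otimes1^{\otimes(4-i)}$. $B_4$ acts on $V^{\otimes4}$ by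 $\sigma_i=1^{\otimes(i-1)}\otimes\mathsf R\otimes1^{\otimes(3-i)}$ with $$\mathsf R(u_i\otimes u_j)=s^{-(i+j)}\sum_{a=0}^{\min(i,2-j)} q^{2(i-a)(j+a)}q^{a(a-1)/2}\begin{bmatrix} a+j\\ j\end{bmatrix}\prod_{m=0}^{a-1}\{m+j+1\}\;u_{j+a}\otimes u_{i-a},$$ commuting with $E,F$. Let $\boldsymbol V_{4,\ell}$ be the span of $u_{\varepsilon_1}\otimes\cdots\otimes u_{\varepsilon_4}$ with $\sum\varepsilon_i=\ell$, $\boldsymbol W_{4,\ell}=\ker(E)\cap\boldsymbol V_{4,\ell}$, and $\boldsymbol S_{4,2}=F(\boldsymbol W_{4,1})\subset\boldsymbol W_{4,2}$, which is a $3$-dimensional $B_4$-submodule of the $6$-dimensional module $\boldsymbol W_{4,2}$. *)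

(* Defs.v *)
From HB Require Import structures.
From mathcomp Require Import all_boot all_order all_algebra.
From mathcomp Require Import generic_quotient ring_quotient complex.
From mathcomp Require Import reals trigo.

Set Implicit Arguments.
Unset Strict Implicit.
Unset Printing Implicit Defensive.

Import GRing.Theory.

Local Open Scope ring_scope.

Section QuotientSpace.
Local Open Scope quotient_scope.
Variables (K : fieldType) (vT : vectType K) (U : {vspace vT}).

Definition quotv : Type := Quotient.quot (@pred_of_vspace K vT U).
HB.instance Definition _ := Choice.on quotv.
HB.instance Definition _ := GRing.Zmodule.on quotv.
HB.instance Definition _ :=
  EqQuotient.copy quotv (Quotient.quot (@pred_of_vspace K vT U)).

Definition quotv_pi (v : vT) : quotv := \pi_quotv v.

Definition scaleqv (a : K) (x : quotv) : quotv := quotv_pi (a *: repr x).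

Fact quotv_piP (v w : vT) : reflect (quotv_pi v = quotv_pi w) (v - w \in U).
Proof.
rewrite (Quotient.idealrBE (@pred_of_vspace K vT U)).
exact: eqP.
Qed.

Fact quotv_piD : {morph quotv_pi : v w / v + w}.
Proof. by move=> v w; apply: (Quotient.pi_add (@pred_of_vspace K vT U)). Qed.

Fact scaleqv_pi a v : scaleqv a (quotv_pi v) = quotv_pi (a *: v).
Proof.
apply/quotv_piP; rewrite -scalerBr; apply: rpredZ.
by apply/quotv_piP; rewrite /quotv_pi reprK.
Qed.

Fact quotv_piK (x : quotv) : quotv_pi (repr x) = x.
Proof. exact: reprK. Qed.

Fact scaleqvA a b x : scaleqv a (scaleqv b x) = scaleqv (a * b) x.
Proof. by rewrite -(quotv_piK x) !scaleqv_pi scalerA. Qed.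

Fact scale1qv : left_id 1 scaleqv.
Proof. by move=> x; rewrite -(quotv_piK x) scaleqv_pi scale1r. Qed.

Fact scaleqvDr : right_distributive scaleqv +%R.
Proof.
move=> a x y; rewrite -(quotv_piK x) -(quotv_piK y).
by rewrite -quotv_piD !scaleqv_pi -quotv_piD scalerDr.
Qed.

Fact scaleqvDl x : {morph scaleqv^~ x : a b / a + b}.
Proof.
by move=> a b; rewrite -(quotv_piK x) !scaleqv_pi -quotv_piD scalerDl.
Qed.

HB.instance Definition _ := GRing.Zmodule_isLmodule.Build K quotv
  scaleqvA scale1qv scaleqvDr scaleqvDl.

End QuotientSpace.

Section Subquotient.
Variables (K : fieldType) (vT : vectType K).
Implicit Types (W S : {vspace vT}) (f : 'End(vT)).

(* W / S; it is the usual quotient when S <= W. *)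
Definition subquot W S := quotv (linfun (@vsval K vT W) @^-1: S)%VS.

Definition stable f W := (f @: W <= W)%VS.

(* The endomorphism w + S |-> f w + S of W / S. The projection vsproj W is the
   identity on W, so this is independent of the representative as soon as
   f stabilizes both W and S. *)
Definition subquot_map W S f (x : subquot W S) : subquot W S :=
  quotv_pi _ (vsproj W (f (vsval (repr x)))).

End Subquotient.

Section BraidRepresentations.
Variables (n : nat) (K : fieldType).

(* A representation of B_n, given by the images of the n-1 Artin generators;
   the generator sigma_(i+1) is indexed by i. *)
Record is_braid_rep (V : lmodType K) (g : 'I_n.-1 -> V -> V) : Prop := {
  braid_linear : forall i, linear (g i);
  braid_bij : forall i, bijective (g i);
  braid_far : forall i j : 'I_n.-1, (i.+1 < j)%N ->
    forall v, g i (g j v) = g j (g i v);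
  braid_near : forall i j : 'I_n.-1, i.+1 = j :> nat ->
    forall v, g i (g j (g i v)) = g j (g i (g j v))
}.

(* A representation of H_n = K B_n / ((sigma_1 - x)(sigma_1 - y)(sigma_1 - z)) *)
Definition is_cubic_hecke_rep (x y z : K) (V : lmodType K)
    (g : 'I_n.-1 -> V -> V) : Prop :=
  is_braid_rep g /\
  forall i : 'I_n.-1, i = 0 :> nat ->
    let shifted t v := g i v - t *: v in
    forall v, shifted x (shifted y (shifted z v)) = 0.

Definition equivalent_reps (V V' : lmodType K)
    (g : 'I_n.-1 -> V -> V) (g' : 'I_n.-1 -> V' -> V') : Prop :=
  exists f : {linear V -> V'},
    bijective f /\ forall i v, f (g i v) = g' i (f v).

End BraidRepresentations.

Section Hecke3.
Variables (K : fieldType) (x y z : K).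

Definition hecke3_odd : 'M[K]_3 := \matrix_(i, j) nth 0 (nth [::]
  [:: [:: z;                0; 0];
      [:: x * z + y ^+ 2;   y; 0];
      [:: y;                1; x]] i) j.

Definition hecke3_even : 'M[K]_3 := \matrix_(i, j) nth 0 (nth [::]
  [:: [:: x; -1;  y];
      [:: 0;  y;  - (x * z) - y ^+ 2];
      [:: 0;  0;  z]] i) j.

(* sigma_1, sigma_3 have indices 0 and 2, sigma_2 has index 1. *)
Definition hecke3 (i : 'I_4.-1) (v : 'cV[K]_3) : 'cV[K]_3 :=
  (if odd i then hecke3_even else hecke3_odd) *m v.

End Hecke3.

Section LinearExtension.
Variables (K : fieldType) (I : finType) (vT : vectType K) (g : I -> vT).

(* The linear map sending the I-indexed standard basis to g. *)
Definition linext : 'Hom({ffun I -> K^o}, vT) :=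
  linfun (fun v : {ffun I -> K^o} => \sum_i v i *: g i).

Fact linextE (v : {ffun I -> K^o}) : linext v = \sum_i v i *: g i.
Proof.
pose h (v : {ffun I -> K^o}) := \sum_i v i *: g i.
have h_lin : linear h.
  move=> a v1 v2; rewrite /h scaler_sumr -big_split; apply: eq_bigr => i _.
  by rewrite !ffunE scalerDl scalerA.
pose H := GRing.isLinear.Build _ _ _ _ h h_lin.
pose hL : {linear _ -> _} := HB.pack h H.
exact: (lfunE hL).
Qed.

End LinearExtension.

Section QuantumModule.
Variables (K : fieldType) (q : K).

Let s := q ^+ 2.

Definition qbrace (n : nat) : K := q ^+ n - q ^- n.
Definition qnum (n : nat) : K := qbrace n / qbrace 1.
Definition qfact (n : nat) : K := \prod_(1 <= m < n.+1) qnum m.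
Definition qbinom (a b : nat) : K := qfact a / (qfact (a - b) * qfact b).

Definition V := {ffun 'I_3 -> K^o}.

(* u_m, which is 0 unless m = 0, 1, 2. *)
Definition u (m : int) : V := [ffun i : 'I_3 => (Posz i == m)%:R].

Definition Eop : 'End(V) := linext (fun m : 'I_3 => u (Posz m - 1)).
Definition Fop : 'End(V) :=
  linext (fun m : 'I_3 => (qnum m.+1 * qnum (2 - m)) *: u (Posz m + 1)).
Definition Kop : 'End(V) :=
  linext (fun m : 'I_3 => (s * q ^- (2 * m)) *: u (Posz m)).

(* V^{(x) 4}: coordinates in the basis u_(e 0) (x) ... (x) u_(e 3). *)
Definition V4 := {ffun {ffun 'I_4 -> 'I_3} -> K^o}.

Definition tens (w : 'I_4 -> V) : V4 :=
  [ffun e : {ffun 'I_4 -> 'I_3} => \prod_p w p (e p)].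

Definition tensop (A : 'I_4 -> 'End(V)) : 'End(V4) :=
  linext (fun e : {ffun 'I_4 -> 'I_3} => tens (fun p => A p (u (Posz (e p))))).

Definition E4 : 'End(V4) := \sum_(i < 4) tensop (fun p =>
  if (p < i)%N then \1%VF else if p == i then Eop else Kop).

Definition F4 : 'End(V4) := \sum_(i < 4) tensop (fun p =>
  if (p < i)%N then (Kop^-1)%VF else if p == i then Fop else \1%VF).

(* The coefficient of u_(j+a) (x) u_(i-a) in R (u_i (x) u_j). *)
Definition Rcoef (i j a : nat) : K :=
  s ^- (i + j) * q ^+ (2 * (i - a) * (j + a)) * q ^+ (a * a.-1)./2
  * qbinom (a + j) j * \prod_(0 <= m < a) qbrace (m + j + 1).

(* 1^{(x) k} (x) R (x) 1^{(x) (2-k)}, i.e. sigma_(k+1). *)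
Definition sigma (k : 'I_4.-1) : 'End(V4) :=
  linext (fun e : {ffun 'I_4 -> 'I_3} =>
    let i : nat := e (inord k) in let j : nat := e (inord k.+1) in
    \sum_(0 <= a < (minn i (2 - j)).+1) Rcoef i j a *: tens (fun p =>
      if p == k :> nat then u (Posz (j + a))
      else if p == k.+1 :> nat then u (Posz (i - a))
      else u (Posz (e p)))).

Definition Vspace (l : nat) : {vspace V4} :=
  (\sum_(e : {ffun 'I_4 -> 'I_3} | (\sum_p e p)%N == l)
    <[tens (fun p => u (Posz (e p)))]>)%VS.

Definition Wspace (l : nat) : {vspace V4} := (lker E4 :&: Vspace l)%VS.

Definition Sspace : {vspace V4} := (F4 @: Wspace 1)%VS.

Definition W2modS (k : 'I_4.-1) :
  subquot (Wspace 2) Sspace -> subquot (Wspace 2) Sspace :=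
  subquot_map (sigma k).

End QuantumModule.

(* e^{i t}, through Euler's formula. *)
Definition expi (R : realType) (t : R) : R[i] := (cos t +i* sin t)%C.

(* Main.v *)
From HB Require Import structures.
Require Import Defs.
From mathcomp Require Import all_boot all_order all_algebra.
From mathcomp Require Import generic_quotient complex reals trigo.
From mathcomp Require Import ring.

(* Let q^2 = q - 1. The four equations E v = 0 on the 10-dimensional weight
   space V_{4,2} leave six coordinates free, so W_{4,2} has an explicit basis in
   which sigma_1, sigma_2, sigma_3 act by 6 x 6 matrices. Let M_k be the matrices
   of the Hecke representation at x = q^5, y = z = 1. Solving the linear equations
   L sigma_k = M_k L on W_{4,2} and L F = 0 on W_{4,1} gives a map
   L : W_{4,2} -> C^3, unique up to a scalar. It is onto and its kernel is exactly
   S_{4,2}; this single map yields the equivalence, and with it the stability of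
   S_{4,2} and the braid relations on the quotient. *)

Set Implicit Arguments.
Unset Strict Implicit.
Unset Printing Implicit Defensive.

Import Order.TTheory GRing.Theory Num.Theory.

Local Open Scope ring_scope.

(** * Transport of the braid relations along an equivalence *)

Lemma braid_rep_transfer n (K : fieldType) (V V' : lmodType K)
    (g : 'I_n.-1 -> V -> V) (g' : 'I_n.-1 -> V' -> V') :
  equivalent_reps g g' -> is_braid_rep g' -> is_braid_rep g.
Proof.
case=> f [fbij fg] [lin bij far near]; have finj := bij_inj fbij.
split.
(* Every law is checked after applying the injective [f], which turns [g] into [g']. The inverse of
   [g i] is that of [g' i] conjugated by [f]. *)
- move=> i a v w; apply: finj.
  by rewrite fg linearP (lin i a) -!fg -linearP.
- move=> i; case: fbij => h fK hK; case: (bij i) => h' gK hgK.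
  exists (fun v => h (h' (f v))) => v; first by rewrite fg gK fK.
  by apply: finj; rewrite fg hK hgK.
- by move=> i j ij v; apply: finj; rewrite !fg far.
- by move=> i j ij v; apply: finj; rewrite !fg near.
Qed.

(** * First isomorphism theorem for a subquotient with operators *)

Section SubquotientIsomorphism.
Variables (n : nat) (K : fieldType) (vT : vectType K) (V' : lmodType K).
Variables (W S : {vspace vT}) (g : 'I_n.-1 -> 'End(vT)).
Variables (g' : 'I_n.-1 -> V' -> V') (phi : {linear vT -> V'}).
Hypothesis stableW : forall k, stable (g k) W.
Hypothesis phi_ker : {in W, forall w, (phi w == 0) = (w \in S)}.
Hypothesis phi_surj : forall c, exists2 w, w \in W & phi w = c.
Hypothesis phi_g : forall k, {in W, forall w, phi (g k w) = g' k (phi w)}.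

Let f (x : subquot W S) : V' := phi (vsval (repr x)).

(** Both implications come from [phi_ker] at [v - w]. Right to left it makes the map induced on W /
    S well defined, left to right it makes that map injective. *)
Let phi_eq (v w : subvs_of W) : phi (vsval v) = phi (vsval w) <->
  quotv_pi (linfun (@vsval K vT W) @^-1: S)%VS v = quotv_pi _ w.
Proof.
have phi_sub : (phi (vsval v) == phi (vsval w)) =
    (v - w \in linfun (@vsval K vT W) @^-1: S)%VS.
  rewrite -memv_preim lfunE -phi_ker; last exact: (subvsP (v - w)).
  by rewrite !linearB subr_eq0.
split=> [/eqP|/quotv_piP]; first by rewrite phi_sub => /quotv_piP.
by rewrite -phi_sub => /eqP.
Qed.

Let f_pi v : f (quotv_pi _ v) = phi (vsval v).
Proof. by apply/phi_eq; rewrite quotv_piK. Qed.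

Lemma subquot_equiv : equivalent_reps (fun k => @subquot_map _ _ W S (g k)) g'.
Proof.
have f_lin : linear f.
  move=> a x y; rewrite -(quotv_piK x) -(quotv_piK y).
  rewrite [a *: _]scaleqv_pi -quotv_piD.
  by rewrite !f_pi -linearP.
pose fL : {linear _ -> _} := HB.pack f (GRing.isLinear.Build _ _ _ _ f f_lin).
exists fL; split.
  have f_inj : injective f.
    by move=> x y; rewrite -(quotv_piK x) -(quotv_piK y) !f_pi => /phi_eq.
  (* The boolean equality lets [xchoose] pick preimages, which form the inverse map. *)
  have f_surj c : exists x, f x == c.
    have [w wW <-] := phi_surj c.
    by exists (quotv_pi _ (Subvs wW)); rewrite f_pi.
  exists (fun c => xchoose (f_surj c)) => [x|c].
    by apply: f_inj; apply/eqP/(xchooseP (f_surj (f x))).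
  exact/eqP/(xchooseP (f_surj c)).
(* By [stableW] the image already lies in [W], so the projection inside [subquot_map] does not move
   it. *)
move=> k x /=; rewrite f_pi vsprojK ?phi_g ?subvsP //.
by apply: (subvP (stableW k)); rewrite memv_img ?subvsP.
Qed.

(** On [W], membership in [S] means being killed by [phi], and [phi] intertwines [g k] with a map
    that fixes 0. *)
Lemma subquot_stable k : (S <= W)%VS -> g' k 0 = 0 -> stable (g k) S.
Proof.
move=> SW g'0; apply/subvP => _ /memv_imgP[w wS ->].
have wW := subvP SW _ wS; have gW : g k w \in W.
  by apply: (subvP (stableW k)); rewrite memv_img.
move: wS; rewrite -!phi_ker ?phi_g // => /eqP->.
by rewrite g'0.
Qed.

End SubquotientIsomorphism.

(** * The Hecke matrices as a representation of H_4 *)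

Section HeckeMatrices.
Variables (K : fieldType) (x y z : K).

Lemma hecke3_near : let A := hecke3_odd x y z in let B := hecke3_even x y z in
  A *m (B *m A) = B *m (A *m B).
Proof.
move=> A B; apply/matrixP => i j; rewrite /A /B !mxE !big_ord_recr !big_ord0 /=.
rewrite !mxE !big_ord_recr !big_ord0 /= !mxE.
by case: i j => [[|[|[|//]]] ?] [[|[|[|//]]] ?] /=; ring.
Qed.

(** This is Cayley-Hamilton for a lower triangular matrix with diagonal z, y, x, verified entry by
    entry. *)
Lemma hecke3_cubic : let A := hecke3_odd x y z in
  (A - x%:M) *m ((A - y%:M) *m (A - z%:M)) = 0.
Proof.
move=> A; apply/matrixP => i j; rewrite /A !mxE !big_ord_recr !big_ord0 /=.
rewrite !mxE !big_ord_recr !big_ord0 /= !mxE.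
by case: i j => [[|[|[|//]]] ?] [[|[|[|//]]] ?] /=; ring.
Qed.

(** Both matrices are triangular of determinant xyz, so nonzero parameters make them invertible. *)
Lemma hecke3_cubic_rep : x != 0 -> y != 0 -> z != 0 ->
  is_cubic_hecke_rep (n := 4) x y z (hecke3 x y z).
Proof.
move=> x0 y0 z0.
have det_odd : \det (hecke3_odd x y z) = x * y * z.
  rewrite det_trig; last first.
    by apply/is_trig_mxP => -[[|[|[|//]]] ?] [[|[|[|//]]] ?]; rewrite ?mxE.
  by rewrite !big_ord_recr big_ord0 !mxE /=; ring.
have det_even : \det (hecke3_even x y z) = x * y * z.
  rewrite -det_tr det_trig; last first.
    by apply/is_trig_mxP => -[[|[|[|//]]] ?] [[|[|[|//]]] ?]; rewrite ?mxE.
  by rewrite !big_ord_recr big_ord0 !mxE /=; ring.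
have unit i : (if odd i then hecke3_even x y z else hecke3_odd x y z)
    \in unitmx.
  by case: (odd i); rewrite unitmxE ?det_even ?det_odd unitfE !mulf_neq0.
split; last first.
  case=> [[|//] i3] _ shifted v.
  have shiftedE t w : shifted t w = (hecke3_odd x y z - t%:M) *m w.
    by rewrite mulmxBl mul_scalar_mx.
  by rewrite !shiftedE (mulmxA (_ - y%:M)) mulmxA hecke3_cubic mul0mx.
split.
- by move=> i a v w; rewrite /hecke3 linearP.
- move=> i; exists (mulmx (invmx (if odd i then hecke3_even x y z
    else hecke3_odd x y z))) => v.
    by rewrite /hecke3 mulKmx.
  by rewrite /hecke3 mulKVmx.
(* The only far pair is sigma_1, sigma_3, and both are given by the same matrix. *)
- by case=> [[|[|[|//]]] ?] [[|[|[|//]]] ?].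
- have near v : let A := hecke3_odd x y z in let B := hecke3_even x y z in
    A *m (B *m (A *m v)) = B *m (A *m (B *m v)).
    by rewrite /= (mulmxA (hecke3_even _ _ _)) mulmxA hecke3_near -!mulmxA.
  by case=> [[|[|[|//]]] ?] [[|[|[|//]]] ?] //= _ v; rewrite /hecke3 /= near.
Qed.

End HeckeMatrices.

(** * The basis of the fourth tensor power, indexed by words *)

Section TensorBasis.
Variables (K : fieldType) (q : K).

(** Words are lists of naturals because lists, unlike finite functions, reduce in the coordinate
    computations. *)
Definition code (e : {ffun 'I_4 -> 'I_3}) : seq nat :=
  mkseq (fun p => nat_of_ord (e (inord p))) 4.

Definition word (s : seq nat) : {ffun 'I_4 -> 'I_3} :=
  [ffun p : 'I_4 => inord (nth 0%N s p)].

Definition valid (s : seq nat) := (size s == 4) && all (fun m => m < 3)%N s.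

(** Letters are unbounded: [u] vanishes beyond 2, so a four-letter word with a letter above 2 stands
    for 0, as happens when F raises u_2. *)
Definition bas (s : seq nat) : V4 K :=
  tens (fun p => u K (Posz (nth 0%N s p))).

Definition comb (B : seq (seq nat)) (c : seq K) : V4 K :=
  \sum_(x <- zip c B) x.1 *: bas x.2.

Lemma nth_code e (p : 'I_4) : nth 0%N (code e) p = e p.
Proof. by rewrite nth_mkseq ?inord_val. Qed.

Lemma codeK : cancel code word.
Proof. by move=> e; apply/ffunP => p; rewrite ffunE nth_code inord_val. Qed.

Lemma wordK s : valid s -> code (word s) = s.
Proof.
case/andP=> /eqP s4 /allP s3; apply: (@eq_from_nth _ 0%N) => [|p].
  by rewrite size_mkseq s4.
rewrite size_mkseq => p4; rewrite (nth_code _ (Ordinal p4)) ffunE inordK //.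
by apply: s3; rewrite mem_nth ?s4.
Qed.

Lemma eq_tens (w w' : 'I_4 -> V K) : w =1 w' -> tens w = tens w'.
Proof.
move=> ww'; apply/ffunP => e; rewrite !ffunE.
by apply: eq_bigr => p _; rewrite ww'.
Qed.

Lemma tensZ (c : 'I_4 -> K) (w : 'I_4 -> V K) :
  tens (fun p => c p *: w p) = (\prod_p c p) *: tens w.
Proof.
apply/ffunP => e; rewrite !ffunE -[_ *: _]/(_ * _) -big_split /=.
by apply: eq_bigr => p _; rewrite ffunE.
Qed.

Lemma tens_bas (e : {ffun 'I_4 -> 'I_3}) :
  tens (fun p => u K (Posz (e p))) = bas (code e).
Proof. by apply: eq_tens => p; rewrite nth_code. Qed.

Lemma basE s e : size s = 4 -> bas s e = (code e == s)%:R.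
Proof.
move=> s4; rewrite ffunE; have [<-|/eqP ne] := eqVneq (code e) s.
  by rewrite big1 // => p _; rewrite ffunE nth_code eqxx.
have [p /eqP np] : exists p : 'I_4, e p != nth 0%N s p :> nat.
  apply/existsP; rewrite -negb_forall; apply/forallP => es; apply: ne.
  apply: (@eq_from_nth _ 0%N) => [|p]; first by rewrite size_mkseq s4.
  by rewrite size_mkseq => p4; rewrite (nth_code _ (Ordinal p4)) (eqP (es _)).
rewrite (bigD1 p) //= ffunE.
by case: eqP => [[]//|_]; rewrite mul0r.
Qed.

Lemma linext_bas (vT : vectType K) (g : _ -> vT) s : valid s ->
  linext g (bas s) = g (word s).
Proof.
move=> vs; have s4 : size s = 4 by case/andP: vs => /eqP.
rewrite linextE (bigD1 (word s)) //= basE // wordK // eqxx scale1r.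
rewrite big1 ?addr0 // => e ne.
rewrite basE // -(inj_eq (can_inj codeK)) in ne *.
by rewrite wordK // in ne; rewrite (negPf ne) scale0r.
Qed.

Lemma tensop_bas A s : valid s ->
  tensop A (bas s) = tens (fun p => A p (u K (Posz (nth 0%N s p)))).
Proof.
move=> vs; rewrite linext_bas //; apply: eq_tens => p.
by rewrite -nth_code wordK.
Qed.

Lemma linext_u (vT : vectType K) (g : 'I_3 -> vT) (m : 'I_3) :
  linext g (u K (Posz m)) = g m.
Proof.
rewrite linextE (bigD1 m) //= ffunE eqxx scale1r big1 ?addr0 // => i im.
by rewrite ffunE eqz_nat (inj_eq val_inj) (negPf im) scale0r.
Qed.

Definition kweight m := q ^+ 2 * q ^- (2 * m).
Definition fweight m := qnum q m.+1 * qnum q (2 - m).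

(** The convention u_{-1} = 0 is carried by the coefficient, so that letters remain natural
    numbers. *)
Lemma Eop_u m : (m < 3)%N ->
  Eop K (u K (Posz m)) = (0 < m)%:R *: u K (Posz m.-1).
Proof.
move=> m3; rewrite (linext_u _ (Ordinal m3)) /=; case: m m3 => [|m] _.
  by rewrite scale0r; apply/ffunP => i; rewrite !ffunE.
by rewrite scale1r /=; congr (u K _); rewrite -addn1 PoszD addrK.
Qed.

Lemma Kop_u m : (m < 3)%N -> Kop q (u K (Posz m)) = kweight m *: u K (Posz m).
Proof. by move=> m3; rewrite (linext_u _ (Ordinal m3)). Qed.

Lemma Fop_u m : (m < 3)%N ->
  Fop q (u K (Posz m)) = fweight m *: u K (Posz m.+1).
Proof.
move=> m3; rewrite (linext_u _ (Ordinal m3)) /=; congr (_ *: u K _).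
by rewrite -addn1 PoszD.
Qed.

(** The inverse of a linear function is in general only a pseudo-inverse. Here K is diagonal with
    nonzero entries, hence injective, and its inverse really undoes it. *)
Lemma KopV_u m : q != 0 -> (m < 3)%N ->
  (Kop q)^-1%VF (u K (Posz m)) = (kweight m)^-1 *: u K (Posz m).
Proof.
move=> q0 m3; have k0 j : kweight j != 0.
  by rewrite mulf_neq0 ?invr_eq0 ?expf_neq0.
have kerK : lker (Kop q) == 0%VS.
  apply/lker0P => v w; rewrite !linextE => /ffunP vw; apply/ffunP => i.
  have coef (x : V K) : (\sum_j x j *:
      ((q ^+ 2 * q ^- (2 * j)) *: u K (Posz j))) i = x i * kweight i.
    rewrite sum_ffunE (bigD1 i) //= big1 ?addr0 => [|j ji].
      by rewrite !ffunE eqxx -![_ *: _]/(_ * _) mulr1.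
    rewrite !ffunE eqz_nat (inj_eq val_inj) eq_sym (negPf ji).
    by rewrite !scaler0.
  by have := vw i; rewrite !coef => /(mulIf (k0 i)).
rewrite -{1}[u K _](scalerK (k0 m)) linearZ /=; congr (_ *: _).
by rewrite -Kop_u // lker0_lfunK.
Qed.

Lemma validP s : valid s -> size s = 4 /\ forall p, (nth 0%N s p < 3)%N.
Proof.
case/andP=> /eqP s4 /allP s3; split=> // p.
have [ps|ps] := ltnP p (size s); first exact/s3/mem_nth.
by rewrite nth_default.
Qed.

Lemma E4_bas s : valid s -> E4 q (bas s) = \sum_(i < 4)
  (\prod_(p < 4) if (p < i)%N then 1
     else if p == i then (0 < nth 0%N s i)%:R else kweight (nth 0%N s p))
  *: bas (set_nth 0%N s i (nth 0%N s i).-1).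
Proof.
move=> vs; have [s4 s3] := validP vs.
rewrite sum_lfunE; apply: eq_bigr => i _; rewrite tensop_bas // -tensZ.
apply: eq_tens => p; rewrite nth_set_nth /=.
case: ltngtP => [pi|pi|/val_inj ->].
- by rewrite lfunE scale1r.
- by rewrite -val_eqE /= gtn_eqF // Kop_u.
- by rewrite !eqxx Eop_u.
Qed.

Lemma F4_bas s : q != 0 -> valid s -> F4 q (bas s) = \sum_(i < 4)
  (\prod_(p < 4) if (p < i)%N then (kweight (nth 0%N s p))^-1
     else if p == i then fweight (nth 0%N s i) else 1)
  *: bas (set_nth 0%N s i (nth 0%N s i).+1).
Proof.
move=> q0 vs; have [s4 s3] := validP vs.
rewrite sum_lfunE; apply: eq_bigr => i _; rewrite tensop_bas // -tensZ.
apply: eq_tens => p; rewrite nth_set_nth /=.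
case: ltngtP => [pi|pi|/val_inj ->].
- by rewrite KopV_u.
- by rewrite -val_eqE /= gtn_eqF // lfunE scale1r.
- by rewrite !eqxx Fop_u.
Qed.

Lemma sigma_bas (k : 'I_4.-1) s : valid s -> sigma q k (bas s) =
  let i := nth 0%N s k in let j := nth 0%N s k.+1 in
  \sum_(0 <= a < (minn i (2 - j)).+1) Rcoef q i j a *:
    bas (set_nth 0%N (set_nth 0%N s k (j + a)%N) k.+1 (i - a)%N).
Proof.
move=> vs; have [s4 s3] := validP vs; rewrite linext_bas //=.
have ws p : (p < 4)%N -> word s (inord p) = nth 0%N s p :> nat.
  by move=> p4; rewrite ffunE inordK // inordK.
rewrite !ws; [|exact: (ltn_ord k)|exact: ltnW (ltn_ord k)].
apply: eq_bigr => a _; congr (_ *: _); apply: eq_tens => p.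
rewrite !nth_set_nth /= !nth_set_nth /=.
case: eqP => [->|_]; first by rewrite ltn_eqF.
by case: eqP => // _; rewrite ffunE inordK.
Qed.

(** A sum of lines becomes a vanishing condition on coordinates, from which vectors of given weight
    can be expanded. *)
Lemma memVspaceP l (v : V4 K) :
  reflect (forall e, sumn (code e) != l -> v e = 0) (v \in Vspace K l).
Proof.
have sumE (e : {ffun 'I_4 -> 'I_3}) : (\sum_p e p)%N = sumn (code e).
  by under eq_bigr do rewrite -nth_code; rewrite !big_ord_recl big_ord0.
apply: (iffP idP) => [|v0].
  case/memv_sumP=> w wL -> e le; rewrite sum_ffunE big1 // => e' le'.
  have /vlineP[c ->] := wL _ le'.
  rewrite ffunE tens_bas basE ?size_mkseq //.
  case: eqP => [ee'|_]; last by rewrite scaler0.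
  by rewrite ee' -sumE le' in le.
have -> : v = \sum_(e : {ffun 'I_4 -> 'I_3} | (\sum_p e p)%N == l)
    v e *: bas (code e).
  apply/ffunP => e; rewrite sum_ffunE.
  have [le|le] := boolP ((\sum_p e p)%N == l).
    rewrite (bigD1 e) //= big1 => [|e' /andP[_ ne]].
      by rewrite ffunE basE ?size_mkseq // eqxx addr0 -[_ *: _]/(_ * _) mulr1.
    rewrite ffunE basE ?size_mkseq // (inj_eq (can_inj codeK)) eq_sym.
    by rewrite (negPf ne) scaler0.
  rewrite v0 -?sumE // big1 // => e' le'; rewrite ffunE basE ?size_mkseq //.
  rewrite (inj_eq (can_inj codeK)).
  case: eqP => [ee'|_]; last by rewrite scaler0.
  by rewrite ee' le' in le.
apply: memv_sumr => e _; rewrite -tens_bas.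
by apply: memvZ; apply: memv_line.
Qed.

Lemma combE B c e : all valid B ->
  comb B c e = \sum_(x <- zip c B) x.1 * (code e == x.2)%:R.
Proof.
rewrite /comb sum_ffunE; elim: B c => [|s B IH] [|a c] //=; rewrite ?big_nil //.
case/andP=> vs vB; rewrite !big_cons IH //= ffunE basE //.
by have [] := validP vs.
Qed.

Lemma supp_comb B (v : V4 K) : uniq B -> all valid B ->
    (forall e, code e \notin B -> v e = 0) ->
  v = comb B [seq v (word s) | s <- B].
Proof.
move=> uB vB v0; apply/ffunP => e; rewrite combE //.
have -> : zip [seq v (word s) | s <- B] B = [seq (v (word s), s) | s <- B].
  by elim: (B) => //= s B' ->.
rewrite big_map /=; have [eB|eB] := boolP (code e \in B).
  rewrite (bigD1_seq (code e)) //= eqxx mulr1 codeK big1 ?addr0 // => s.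
  by rewrite eq_sym => /negPf ->; rewrite mulr0.
rewrite v0 // big_seq big1 // => s sB.
case: eqP => [es|_]; last by rewrite mulr0.
by rewrite es sB in eB.
Qed.

End TensorBasis.

(** * Quantum numbers and R-matrix coefficients when q^2 = q - 1 *)

Section SixthRoot.
Variables (K : fieldType) (q : K).
Hypothesis q2 : q ^+ 2 = q - 1.
Hypothesis qV_neq : q - q^-1 != 0.

Lemma q_neq0 : q != 0.
Proof.
apply: contra_eq_neq q2 => ->; rewrite expr0n /= sub0r eq_sym oppr_eq0.
exact: oner_neq0.
Qed.

Lemma qV : q^-1 = 1 - q.
Proof. by apply: (mulfI q_neq0); rewrite mulfV ?q_neq0 //; ring: q2. Qed.

Lemma qbrace1 : qbrace q 1 = 2 * q - 1.
Proof. by rewrite /qbrace !expr1 qV; ring. Qed.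

Lemma qbrace2 : qbrace q 2 = 2 * q - 1.
Proof. by rewrite /qbrace -exprVn qV; ring: q2. Qed.

Lemma qnum1 : qnum q 1 = 1.
Proof. by rewrite /qnum divff. Qed.

Lemma qnum2 : qnum q 2 = 1.
Proof. by rewrite /qnum qbrace2 -qbrace1 divff. Qed.

(** Since [1] = [2] = 1 at this root, all factorials up to [2]! equal 1. *)
Lemma qbinom1 a b : (a <= 2)%N -> (b <= a)%N -> qbinom q a b = 1.
Proof.
move=> a2 ba.
have fact1 n : (n <= 2)%N -> qfact q n = 1.
  case: n => [|[|[|//]]] _; rewrite /qfact.
  - by rewrite big_geq.
  - by rewrite big_nat1 qnum1.
  - by rewrite big_nat_recr //= big_nat1 qnum1 qnum2 mulr1.
rewrite /qbinom !fact1 ?mulr1 ?divr1 //; first exact: leq_trans a2.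
by rewrite leq_subLR (leq_trans a2) ?leq_addl.
Qed.

(** Here s^{-1} = (1 - q)^2 = -q and {1} = {2} = 2q - 1, the only braces that occur when a + j <= 2.
    The exponents are parameters so that numerals can be supplied to [ring]. *)
Lemma RcoefE i j a m n : (a + j <= 2)%N ->
    (2 * (i - a) * (j + a))%N = m -> (a * a.-1)./2 = n ->
  Rcoef q i j a = (- q) ^+ (i + j) * q ^+ m * q ^+ n * (2 * q - 1) ^+ a.
Proof.
move=> aj <- <-; rewrite /Rcoef qbinom1 ?leq_addl // mulr1.
congr (_ * _ * _ * _).
  by rewrite -exprVn -[q ^+ 2]/(q * q) invfM qV; congr (_ ^+ _); ring: q2.
rewrite -{2}[a]subn0 -prodr_const_nat; apply: eq_big_nat => l /= la.
have : (l + j + 1 <= 2)%N by rewrite addn1 -addSn (leq_trans _ aj) ?leq_add2r.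
by rewrite addn1; case: (l + j)%N => [|[|//]] _; rewrite (qbrace1, qbrace2).
Qed.

Lemma kweightE : [/\ kweight q 0 = q - 1, kweight q 1 = 1 & kweight q 2 = - q].
Proof.
by rewrite /kweight -!exprVn qV; split; ring: q2.
Qed.

Lemma fweightE : fweight q 0 = 1 /\ fweight q 1 = 1.
Proof. by rewrite /fweight qnum1 qnum2 mulr1. Qed.

(** The words of letter sum 1, and then 2, in lexicographic order; all coefficient lists below
    follow this order. *)
Definition words1 : seq (seq nat) :=
  [:: [:: 0; 0; 0; 1]; [:: 0; 0; 1; 0]; [:: 0; 1; 0; 0]; [:: 1; 0; 0; 0]]%N.

Definition words2 : seq (seq nat) :=
  [:: [:: 0; 0; 0; 2]; [:: 0; 0; 1; 1]; [:: 0; 0; 2; 0]; [:: 0; 1; 0; 1];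
      [:: 0; 1; 1; 0]; [:: 0; 2; 0; 0]; [:: 1; 0; 0; 1]; [:: 1; 0; 1; 0];
      [:: 1; 1; 0; 0]; [:: 2; 0; 0; 0]]%N.

Lemma Vspace_comb l B (v : V4 K) : uniq B -> all valid B ->
    (forall e, sumn (code e) = l -> code e \in B) ->
  v \in Vspace K l -> v = comb B [seq v (word s) | s <- B].
Proof.
move=> uB vB lB /memVspaceP v0; apply: supp_comb => // e eB; apply: v0.
by apply: contraNneq eB => /lB.
Qed.

Lemma comb_Vspace l B (c : seq K) : all valid B ->
  all (fun s => sumn s == l) B -> comb B c \in Vspace K l.
Proof.
move=> vB lB; apply/memVspaceP => e el; rewrite combE //.
elim: B c vB lB => [|s B IH] [|a c] //=; rewrite ?big_nil //.
case/andP=> vs vB /andP[/eqP sl lB]; rewrite big_cons IH // addr0 /=.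
have [es|_] := eqVneq (code e) s; last by rewrite mulr0.
by rewrite es sl eqxx in el.
Qed.

Lemma words1P e : sumn (code e) = 1%N -> code e \in words1.
Proof.
(* Made boolean, the implication is settled by evaluation on all 81 words. *)
move=> /eqP; apply/implyP; rewrite /code /mkseq /=.
by do 4! case: (e _) => [[|[|[|//]]] ?].
Qed.

Lemma words2P e : sumn (code e) = 2 -> code e \in words2.
Proof.
move=> /eqP; apply/implyP; rewrite /code /mkseq /=.
by do 4! case: (e _) => [[|[|[|//]]] ?].
Qed.

End SixthRoot.

(** * Explicit action of E, F and the braid generators in low weight *)

Section Weight2.
Variables (K : fieldType) (q : K).
Hypothesis q2 : q ^+ 2 = q - 1.
Hypothesis qV_neq : q - q^-1 != 0.

Lemma E4_bas4 a b c d : valid [:: a; b; c; d] -> E4 q (bas K [:: a; b; c; d]) =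
  ((0 < a)%N%:R * kweight q b * kweight q c * kweight q d) *:
    bas K [:: a.-1; b; c; d]
  + ((0 < b)%N%:R * kweight q c * kweight q d) *: bas K [:: a; b.-1; c; d]
  + ((0 < c)%N%:R * kweight q d) *: bas K [:: a; b; c.-1; d]
  + (0 < d)%N%:R *: bas K [:: a; b; c; d.-1].
Proof.
move=> vs; rewrite E4_bas // !big_ord_recr !big_ord0 /=.
by rewrite add0r !mul1r ?mulr1.
Qed.

Lemma F4_bas4 a b c d : valid [:: a; b; c; d] -> F4 q (bas K [:: a; b; c; d]) =
  fweight q a *: bas K [:: a.+1; b; c; d]
  + ((kweight q a)^-1 * fweight q b) *: bas K [:: a; b.+1; c; d]
  + ((kweight q a)^-1 * (kweight q b)^-1 * fweight q c) *:
    bas K [:: a; b; c.+1; d]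
  + ((kweight q a)^-1 * (kweight q b)^-1 * (kweight q c)^-1 * fweight q d) *:
    bas K [:: a; b; c; d.+1].
Proof.
move=> vs; rewrite F4_bas ?(q_neq0 q2) // !big_ord_recr !big_ord0 /=.
by rewrite add0r !mul1r ?mulr1.
Qed.

Lemma V4_addE (v w : V4 K) e : (v + w) e = v e + w e :> K.
Proof. by rewrite ffunE. Qed.

Lemma V4_scaleE (a : K) (v : V4 K) e : (a *: v) e = a * v e :> K.
Proof. by rewrite ffunE. Qed.

Lemma V4_0E e : (0 : V4 K) e = 0 :> K.
Proof. by rewrite ffunE. Qed.

(* The basis is generalized so that rewriting does not unfold it. *)
Ltac lincomb :=
  rewrite ?invrN ?invr1; apply/ffunP => e; move: (@bas K) => b;
  rewrite !(V4_addE, V4_scaleE, V4_0E);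
  ring: q2.

Lemma E4_words1 c0 c1 c2 c3 : E4 q (comb words1 [:: c0; c1; c2; c3]) =
  (c0 + (q - 1) * c1 + (q - 1) ^+ 2 * c2 + (q - 1) ^+ 3 * c3) *:
    bas K [:: 0; 0; 0; 0]%N.
Proof.
rewrite /comb /= !big_cons !big_nil /= !linearD !linearZ linear0 /=.
rewrite !E4_bas4 //=.
have [-> -> _] := kweightE q2.
lincomb.
Qed.

(** K acts on u_0 by q - 1 and on u_1 by 1; the coefficients use (q - 1)^2 = -q and (q - 1)^3 =
    1. *)
Lemma E4_words2 c0 c1 c2 c3 c4 c5 c6 c7 c8 c9 :
  E4 q (comb words2 [:: c0; c1; c2; c3; c4; c5; c6; c7; c8; c9]) =
  comb words1 [:: c0 + c1 + (q - 1) * c3 - q * c6;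
    c1 + (q - 1) * c2 + (q - 1) * c4 - q * c7;
    c3 + (q - 1) * c4 - q * c5 - q * c8;
    c6 + (q - 1) * c7 - q * c8 + c9].
Proof.
rewrite /comb /= !big_cons !big_nil /= !linearD !linearZ linear0 /=.
rewrite !E4_bas4 //=.
have [-> -> ->] := kweightE q2.
lincomb.
Qed.

Lemma F4_words1 c0 c1 c2 c3 :
  F4 q (comb words1 [:: c0; c1; c2; c3]) =
  comb words2 [:: c0; (q - 1) * c0 + (q - 1) * c1; (q - 1) * c1;
    - q * c0 + (q - 1) * c2; - q * c1 - q * c2; - q * c2; c0 + (q - 1) * c3;
    c1 - q * c3; c2 + c3; c3].
Proof.
rewrite /comb /= !big_cons !big_nil /= !linearD !linearZ linear0 /=.
rewrite !F4_bas4 //=.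
have [-> -> _] := kweightE q2.
have [-> ->] := fweightE q2 qV_neq.
have -> : (q - 1)^-1 = - q.
  by rewrite -q2 -exprVn qV //; ring: q2.
lincomb.
Qed.

(** These are all the coefficients with i + j <= 2. A product type is used so that the table serves
    as one multi-rule for [rewrite]. *)
Lemma Rcoef_table :
  (((Rcoef q 0 0 0%N = 1) * (Rcoef q 0 1 0 = - q) * (Rcoef q 0 2 0 = q - 1))
  * ((Rcoef q 1 0 0 = - q) * (Rcoef q 1 0 1 = 2 - q))
  * ((Rcoef q 1 1 0 = - q) * (Rcoef q 1 1 1 = - 1 - q))
  * ((Rcoef q 2 0 0 = q - 1) * (Rcoef q 2 0 1 = 2 - q) *
     (Rcoef q 2 0 2 = 3)))%type.
Proof.
do ![split].
(* The exponents (m, n) are (2, 0) at (1,1,0) and (2,0,1), then (0, 1) at (2,0,2), which is goal 8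
   after renumbering, and (0, 0) elsewhere. *)
6,9: by rewrite (@RcoefE _ _ q2 qV_neq _ _ _ 2%N 0%N) //; ring: q2.
8: by rewrite (@RcoefE _ _ q2 qV_neq _ _ _ 0%N 1%N) //; ring: q2.
all: by rewrite (@RcoefE _ _ q2 qV_neq _ _ _ 0%N 0%N) //; ring: q2.
Qed.

(* The parameters are the coordinates of the vector at the words 0020, 0110,
   0200, 1010, 1100, 2000; the other four are solved for from E v = 0. *)
Definition wvec (a : seq K) : V4 K := comb words2
  [:: (q - 1) * a`_0 - a`_1 + a`_2 + (1 - q) * a`_3 + q * a`_4 - q * a`_5;
      (1 - q) * a`_0 + (1 - q) * a`_1 + q * a`_3;
      a`_0;
      (1 - q) * a`_1 + q * a`_2 + q * a`_4;
      a`_1;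
      a`_2;
      (1 - q) * a`_3 + q * a`_4 - a`_5;
      a`_3;
      a`_4;
      a`_5].

(** The 6 x 6 matrices of the generators: row by row, the new coordinates at the six words that
    parametrize [wvec]. *)
Definition sigma_coord (k : nat) (a : seq K) : seq K := nth [::]
  [:: [:: a`_0;
          - q * a`_3;
          (q - 1) * a`_5;
          - q * a`_1 + (2 - q) * a`_3;
          - q * a`_4 + (2 - q) * a`_5;
          (q - 1) * a`_2 - (1 + q) * a`_4 + 3 * a`_5];
      [:: (q - 1) * a`_2;
          - q * a`_1 + (2 - q) * a`_2;
          (q - 1) * a`_0 - (1 + q) * a`_1 + 3 * a`_2;
          - q * a`_4;
          - q * a`_3 + (2 - q) * a`_4;
          a`_5];
      [:: a`_0 - a`_1 + (q - 1) * a`_2 + (1 - q) * a`_3 - a`_4 + a`_5;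
          (1 - q) * a`_1 + (1 - q) * a`_2 + (1 - q) * a`_4;
          a`_2;
          (1 - q) * a`_3 + (1 - q) * a`_4 + q * a`_5;
          a`_4;
          a`_5]] k.

(** All ten coefficients are compared. Agreement at the four dependent words is what makes W_{4,2}
    stable. *)
Lemma sigma_wvec (k : 'I_4.-1) a :
  sigma q k (wvec a) = wvec (sigma_coord k a).
Proof.
rewrite /wvec /comb /= !big_cons !big_nil /= !linearD !linearZ linear0 /=.
do 10! (rewrite sigma_bas; last by []).
case: k => [[|[|[|k]]] k3]; last by case: (notF k3).
all: rewrite /= /minn /= /index_iota /= !big_cons !big_nil /= !Rcoef_table.
all: lincomb.
Qed.

End Weight2.

(** * The quadratic relation for e^{i pi/3} *)

Lemma expi_pi3 (R : realType) (q := expi (pi / 3%:R) : R[i]) : q ^+ 2 = q - 1.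
Proof.
rewrite /q /expi; set t := pi / 3%:R.
have t0 : 0 < t by rewrite divr_gt0 ?pi_gt0 ?ltr0n.
have tpi : t < pi / 2.
  by rewrite ltr_pM2l ?pi_gt0 // ltf_pV2 ?posrE ?ltr0n // ltr_nat.
have c0 : 0 < cos t.
  by apply: cos_gt0_pihalf; rewrite (lt_trans _ t0) ?oppr_lt0 ?divr_gt0 ?pi_gt0.
have cs := cos2Dsin2 t.
have c3 : cos (t + (t + t)) = -1.
  by rewrite -cospi; congr cos; rewrite /t; field.
have c2 : cos t = 1 / 2.
  (* Expanding cos(3t) = -1 gives 4c^3 - 3c + 1 = 0, which factors in this way; c > 0 then leaves c
     = 1/2. *)
  have: (cos t + 1) * (2 * cos t - 1) ^+ 2 = 0.
    move: c3; rewrite !cosD !sinD => c3.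
    have -> : (cos t + 1) * (2 * cos t - 1) ^+ 2 =
      4 * cos t ^+ 3 - 3 * cos t + 1 by ring.
    have s2 : sin t ^+ 2 = 1 - cos t ^+ 2 by rewrite -cs; ring.
    by apply: (addIr (-1)); rewrite add0r -[RHS]c3; ring: s2.
  move/eqP; rewrite mulf_eq0 gt_eqF ?addr_gt0 ?ltr01 //= sqrf_eq0 subr_eq0.
  move/eqP => c2; apply: (mulfI (_ : 2 != 0)); rewrite ?c2 ?pnatr_eq0 //.
  by field.
have s2 : sin t ^+ 2 = 3 / 4.
  by apply: (addrI (cos t ^+ 2)); rewrite cs c2; field.
rewrite expr2; apply/eqP; rewrite eq_complex /= c2 -[sin t * sin t]expr2 s2.
by apply/andP; split; apply/eqP; field.
Qed.

(** * The map [phi]: intertwining, kernel S_{4,2}, surjectivity *)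

Section Quotient.
Variables (K : fieldType) (q : K).
Hypothesis q2 : q ^+ 2 = q - 1.
Hypothesis qV_neq : q - q^-1 != 0.

Ltac eq_coords := congr (comb _ _); do ![congr (_ :: _)]; ring: q2.

(** The parameters are the coordinates at 0010, 0100, 1000; the one at 0001 is solved from E v =
    0. *)
Definition wvec1 (b : seq K) : V4 K :=
  comb words1 [:: (1 - q) * b`_0 + q * b`_1 - b`_2; b`_0; b`_1; b`_2].

(** The list consists of the coordinates of the image at the six free words; that the other four
    also fit [wvec] gives S_{4,2} inside W_{4,2}. *)
Lemma F4_wvec1 b : F4 q (wvec1 b) = wvec q
  [:: (q - 1) * b`_0; - q * b`_0 - q * b`_1; - q * b`_1; b`_0 - q * b`_2;
      b`_1 + b`_2; b`_2].
Proof.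
rewrite /wvec1 F4_words1 // /wvec /=.
eq_coords.
Qed.

Lemma wvec1_W b : wvec1 b \in Wspace q 1.
Proof.
rewrite memv_cap memv_ker comb_Vspace // andbT /wvec1 E4_words1 //.
apply/eqP; rewrite -[RHS](scale0r (bas K [:: 0; 0; 0; 0]%N)); congr (_ *: _).
ring: q2.
Qed.

Lemma W1P v : v \in Wspace q 1 -> exists b, v = wvec1 b.
Proof.
rewrite memv_cap memv_ker => /andP[/eqP Ev vV].
have [c0 [c1 [c2 [c3 cE]]]] :
    exists c0 c1 c2 c3, v = comb words1 [:: c0; c1; c2; c3].
  by do 4 eexists; exact: (Vspace_comb (B := words1) isT isT words1P vV).
have /ffunP/(_ (word [:: 0; 0; 0; 0]%N)) := Ev.
rewrite cE E4_words1 // V4_scaleE basE // wordK // eqxx mulr1 V4_0E => c0E.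
exists [:: c1; c2; c3]; rewrite /wvec1 /=; congr (comb _ _); congr (_ :: _).
by apply: subr0_eq; rewrite -[RHS]c0E; ring: q2.
Qed.

Lemma E4_wvec a : E4 q (wvec q a) = 0.
Proof.
rewrite /wvec E4_words2 //.
have -> : (0 : V4 K) = comb words1 [:: 0; 0; 0; 0].
  by rewrite /comb !big_cons big_nil !scale0r !addr0.
eq_coords.
Qed.

Lemma wvec_W a : wvec q a \in Wspace q 2.
Proof. by rewrite memv_cap memv_ker E4_wvec eqxx comb_Vspace. Qed.

Lemma W2P v : v \in Wspace q 2 -> exists a, v = wvec q a.
Proof.
rewrite memv_cap memv_ker => /andP[/eqP Ev vV].
have [c0 [c1 [c2 [c3 [c4 [c5 [c6 [c7 [c8 [c9 cE]]]]]]]]]] :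
    exists c0 c1 c2 c3 c4 c5 c6 c7 c8 c9,
      v = comb words2 [:: c0; c1; c2; c3; c4; c5; c6; c7; c8; c9].
  by do 10 eexists; exact: (Vspace_comb (B := words2) isT isT words2P vV).
have Ev0 s : E4 q v (word s) = 0 by rewrite Ev V4_0E.
rewrite cE E4_words2 // in Ev0.
(* Reading E v = 0 at the words of weight 1 gives four equations: e3, e2, e1 determine c6, c3, c1,
   and e0 then determines c0. *)
have e0 := Ev0 [:: 0; 0; 0; 1]%N; have e1 := Ev0 [:: 0; 0; 1; 0]%N.
have e2 := Ev0 [:: 0; 1; 0; 0]%N; have e3 := Ev0 [:: 1; 0; 0; 0]%N.
move: e0 e1 e2 e3.
rewrite !combE // !wordK // !big_cons !big_nil /= !mulr1 !mulr0.
rewrite !addr0 !add0r => e0 e1 e2 e3.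
exists [:: c2; c4; c5; c7; c8; c9]; rewrite cE /wvec /=.
have c6E : c6 = (1 - q) * c7 + q * c8 - c9.
  by apply: subr0_eq; rewrite -[RHS]e3; ring.
have c3E : c3 = (1 - q) * c4 + q * c5 + q * c8.
  by apply: subr0_eq; rewrite -[RHS]e2; ring.
have c1E : c1 = (1 - q) * c2 + (1 - q) * c4 + q * c7.
  by apply: subr0_eq; rewrite -[RHS]e1; ring.
have c0E : c0 = q * c6 - c1 - (q - 1) * c3.
  by apply: subr0_eq; rewrite -[RHS]e0; ring.
rewrite c0E c6E c3E c1E.
eq_coords.
Qed.

(* The map L of the header, read off the same six coordinates. *)
Definition phi (v : V4 K) : 'cV[K]_3 := \col_(i < 3) nth 0
  [:: (1 - q) * v (word [:: 0; 2; 0; 0]%N) + v (word [:: 1; 1; 0; 0]%N)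
      - v (word [:: 2; 0; 0; 0]%N);
      - v (word [:: 0; 0; 2; 0]%N) + (1 - q) * v (word [:: 0; 1; 1; 0]%N)
      + (2 * q - 2) * v (word [:: 0; 2; 0; 0]%N)
      + q * v (word [:: 1; 0; 1; 0]%N) - v (word [:: 1; 1; 0; 0]%N)
      + q * v (word [:: 2; 0; 0; 0]%N);
      (q - 1) * v (word [:: 0; 0; 2; 0]%N) - v (word [:: 0; 1; 1; 0]%N)
      + v (word [:: 0; 2; 0; 0]%N)] i.

Lemma phi_linear : linear phi.
Proof.
move=> t v w; apply/matrixP => i j; rewrite !mxE !V4_addE !V4_scaleE.
by case: i => [[|[|[|//]]] ?] /=; ring.
Qed.

HB.instance Definition _ := GRing.isLinear.Build _ _ _ _ phi phi_linear.

Lemma phi_wvec a : phi (wvec q a) = \col_(i < 3) nth 0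
  [:: (1 - q) * a`_2 + a`_4 - a`_5;
      - a`_0 + (1 - q) * a`_1 + (2 * q - 2) * a`_2 + q * a`_3 - a`_4 + q * a`_5;
      (q - 1) * a`_0 - a`_1 + a`_2] i.
Proof.
apply/matrixP => i j; rewrite !mxE !combE // !wordK // !big_cons !big_nil /=.
by case: i => [[|[|[|//]]] ?] /=; ring.
Qed.

Lemma phi_sigma (k : 'I_4.-1) : {in Wspace q 2, forall w,
  phi (sigma q k w) = hecke3 (q ^+ 5) 1 1 k (phi w)}.
Proof.
move=> _ /W2P[a ->]; rewrite sigma_wvec // !phi_wvec.
rewrite /hecke3; apply/matrixP => i j.
rewrite mxE mxE !big_ord_recr big_ord0 /=.
case: k => [[|[|[|//]]] ?]; rewrite /= !mxE;
  by case: i => [[|[|[|//]]] ?] /=; ring: q2.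
Qed.

Lemma S_sub_W : (Sspace q <= Wspace q 2)%VS.
Proof.
apply/subvP => _ /memv_imgP[w /W1P[b ->] ->].
by rewrite F4_wvec1 wvec_W.
Qed.

Lemma phi_kernel : {in Wspace q 2, forall w, (phi w == 0) = (w \in Sspace q)}.
Proof.
move=> _ /W2P[a ->].
apply/eqP/idP => [|/memv_imgP[_ /W1P[b ->] ->]]; last first.
  rewrite F4_wvec1 phi_wvec; apply/matrixP => i j; rewrite !mxE.
  by case: i => [[|[|[|//]]] ?] /=; ring: q2.
rewrite phi_wvec => /matrixP L0.
have := L0 (inord 0) 0; have := L0 (inord 1) 0; have := L0 (inord 2) 0.
rewrite !mxE !inordK //= => e2 e1 e0.
(* The equations leave a_0, a_2, a_5 free, matching the three parameters of [wvec1]. *)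
have a1E : a`_1 = (q - 1) * a`_0 + a`_2.
  by apply/esym/subr0_eq; rewrite -[RHS]e2; ring.
have a4E : a`_4 = a`_5 - (1 - q) * a`_2.
  by apply: subr0_eq; rewrite -[RHS]e0; ring.
(* The factor 1 - q is q^{-1}, dividing out the coefficient of a_3. *)
have a3E : a`_3 = (1 - q) * (a`_0 - (1 - q) * a`_1 - (2 * q - 2) * a`_2
    + a`_4 - q * a`_5).
  apply: subr0_eq; rewrite -[RHS](mulr0 (1 - q)) -[X in _ = _ * X]e1.
  by ring: q2.
(* The preimage solves (q - 1) b_0 = a_0, -q b_1 = a_2, b_2 = a_5 from [F4_wvec1]. *)
have -> : wvec q a = F4 q (wvec1 [:: - q * a`_0; (q - 1) * a`_2; a`_5]).
  rewrite F4_wvec1 /wvec /= a3E a4E a1E.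
  eq_coords.
exact/memv_img/wvec1_W.
Qed.

Lemma phi_surj c : exists2 w, w \in Wspace q 2 & phi w = c.
Proof.
pose c_ (i : nat) := c (inord i) 0.
(* With a_0 = a_2 = a_5 = 0 the outer rows of [phi_wvec] give a_4 and a_1, and the middle row,
   divided by q, gives a_3. *)
exists (wvec q [:: 0; - c_ 2; 0; (1 - q) * (c_ 0 + c_ 1 + (1 - q) * c_ 2);
  c_ 0; 0]); first exact: wvec_W.
rewrite phi_wvec; apply/matrixP => i j; rewrite mxE (ord1 j).
rewrite -[in RHS](inord_val i) -/(c_ i).
by case: i => [[|[|[|//]]] ?] /=; ring: q2.
Qed.

End Quotient.

(** * Assembly over the complex numbers *)

Theorem proposition6p2 (R : realType) :
  let q : R[i] := expi (pi / 3%:R) in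
  [/\ (Sspace q <= Wspace q 2)%VS
        /\ (forall k, stable (sigma q k) (Wspace q 2)
                   /\ stable (sigma q k) (Sspace q)),
      is_braid_rep (n := 4) (W2modS (q := q)),
      is_cubic_hecke_rep (n := 4) (q ^+ 5) 1 1 (hecke3 (q ^+ 5) 1 1) &
      equivalent_reps (n := 4) (W2modS (q := q)) (hecke3 (q ^+ 5) 1 1)].
Proof.
move=> q; have q2 : q ^+ 2 = q - 1 := expi_pi3 R.
have q0 := q_neq0 q2.
have qV_neq : q - q^-1 != 0.
  apply/eqP => qV0; have : 3 = 0 :> R[i].
    (* Indeed q - q^{-1} = 2q - 1, whose square is -3. *)
    transitivity (- (q - q^-1) ^+ 2); last by rewrite qV0 expr0n oppr0.
    by rewrite (qV q2); ring: q2.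
  by move/eqP; rewrite pnatr_eq0.
have SW := S_sub_W q2 qV_neq.
have stW k : stable (sigma q k) (Wspace q 2).
  apply/subvP => _ /memv_imgP[w /(W2P q2)[a ->] ->].
  by rewrite sigma_wvec // wvec_W.
have ker := phi_kernel q2 qV_neq; have phig := phi_sigma q2 qV_neq.
have H : is_cubic_hecke_rep (n := 4) (q ^+ 5) 1 1 (hecke3 (q ^+ 5) 1 1).
  by apply: hecke3_cubic_rep; rewrite ?oner_neq0 ?expf_neq0.
have eqv : equivalent_reps (n := 4) (W2modS (q := q)) (hecke3 (q ^+ 5) 1 1).
  exact: (subquot_equiv (n := 4) stW ker (phi_surj q2) phig).
(* The quotient inherits the braid relations from the Hecke matrices through the equivalence. *)
split; [|by apply: braid_rep_transfer eqv _; case: H|exact: H|exact: eqv].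
split; first exact: SW.
move=> k; split; first exact: stW.
by apply: (subquot_stable (n := 4) stW ker phig SW); rewrite /hecke3 mulmx0.
Qed.
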